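(* Let $\mathcal{A}$ be a $\sigma$-algebra over a nonempty set $X$, and let $\mu,\nu:\mathcal{A}\to\mathbb{R}_+$ be finite measures on $\mathcal{A}$. Then there exists a unique pair $(\mu_{\mathrm{ac}},\mu_{\mathrm{s}})$ of (nonnegative, finite) measures on $\mathcal{A}$ such that $\mu=\mu_{\mathrm{ac}}+\mu_{\mathrm{s}}$, $\mu_{\mathrm{ac}}\ll\nu$, and $\mu_{\mathrm{s}}\perp\nu$.
   Context: All measures are nonnegative, finite and countably additive on $\mathcal{A}$. For measures $\alpha,\beta$ on $\mathcal{A}$: $\alpha\leq\beta$ ($\alpha$ is dominated by $\beta$) means $\alpha(A)\leq\beta(A)$ for all $A\in\mathcal{A}$; $\alpha\ll\beta$ means that $\beta(A)=0$ implies $\alpha(A)=0$ for all $A\in\mathcal{A}$; $\alpha\perp\beta$ (singularity) means that the only measure $\eta$ on $\mathcal{A}$ with $\eta\leq\alpha$ and $\eta\leq\beta$ is the zero measure (this is equivalent to the existence of $P\in\mathcal{A}$ with $\alpha(P)=\beta(X\setminus P)=0$). *)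

(* Defs.v *)
From HB Require Import structures.
From mathcomp Require Import all_boot all_order all_algebra.
From mathcomp Require Import all_classical all_reals all_analysis.

Set Implicit Arguments.
Unset Strict Implicit.
Unset Printing Implicit Defensive.

Import Order.TTheory GRing.Theory Num.Theory.
Import numFieldNormedType.Exports.

Local Open Scope classical_set_scope.
Local Open Scope ring_scope.
Local Open Scope ereal_scope.

(* A library measure on a [measurableType] is a function on all of [set T]
   whose values outside the sigma-algebra carry no meaning.  A measure on the
   sigma-algebra is therefore such a function up to equality on measurable
   sets, and Leibniz equality of two measures would be too strong. *)
Definition measure_eq d (T : measurableType d) (R : realType)
    (alpha beta : set T -> \bar R) : Prop :=
  forall A, measurable A -> alpha A = beta A.

Definition measure_le d (T : measurableType d) (R : realType)
    (alpha beta : set T -> \bar R) : Prop :=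
  forall A, measurable A -> alpha A <= beta A.

Definition singular d (T : measurableType d) (R : realType)
    (alpha beta : {finite_measure set T -> \bar R}) : Prop :=
  forall eta : {finite_measure set T -> \bar R},
    measure_le eta alpha -> measure_le eta beta -> measure_eq eta mzero.

(* [content_dominates nu mu_ac] is mu_ac << nu, with the dominating measure
   first: nu A = 0 implies mu_ac A = 0 for every measurable A. *)
Definition lebesgue_decomposition d (T : measurableType d) (R : realType)
    (mu nu mu_ac mu_s : {finite_measure set T -> \bar R}) : Prop :=
  [/\ measure_eq mu (mu_ac \+ mu_s),
      content_dominates nu mu_ac
    & singular mu_s nu].

(* Main.v *)
Require Import Defs.
From HB Require Import structures.
From mathcomp Require Import all_boot all_order all_algebra.
From mathcomp Require Import all_classical all_reals all_analysis.

Set Implicit Arguments.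
Unset Strict Implicit.
Unset Printing Implicit Defensive.

Import Order.TTheory GRing.Theory Num.Theory.
Import numFieldNormedType.Exports.

Local Open Scope classical_set_scope.
Local Open Scope ring_scope.
Local Open Scope ereal_scope.

(** The singular part of mu is its restriction to a nu-null set N of maximal
    mu-measure: off N, every nu-null set is mu-null, so the restriction of mu
    to the complement of N is the absolutely continuous part.  For uniqueness,
    any other absolutely continuous part vanishes on N, so the other singular
    part agrees with mu there; off N that singular part lies below mu, hence is
    both dominated by nu and singular to nu, and a Hahn decomposition shows
    that such a measure is zero. *)

Lemma finite_measure_lty d (T : measurableType d) (R : realType)
    (mu : {finite_measure set T -> \bar R}) A :
  measurable A -> mu A < +oo.
Proof. by move=> mA; rewrite ltey_eq fin_num_measure. Qed.

Section restriction.
Context d (T : measurableType d) (R : realType).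
Implicit Types mu : {finite_measure set T -> \bar R}.

(** The result is again a finite measure on the whole space, so it can serve both as a test measure
    [eta] in [singular] and as a part of a decomposition. *)
Definition restriction mu D (mD : measurable D) :
    {finite_measure set T -> \bar R} :=
  mfrestr mD (finite_measure_lty mu mD).

Lemma restrictionE mu D (mD : measurable D) A :
  restriction mu mD A = mu (A `&` D).
Proof. by []. Qed.

Lemma restriction_le mu D (mD : measurable D) :
  measure_le (restriction mu mD) mu.
Proof. by move=> A mA; rewrite restrictionE; exact: measureIl. Qed.

End restriction.

Section null_sets_and_singularity.
Context d (T : measurableType d) (R : realType).
Implicit Types mu nu : {finite_measure set T -> \bar R}.

(* N is a countable union of nu-null sets whose mu-measures approach the
   supremum; adding to N a nu-null set that is not mu-null outside N would
   exceed it. *)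
Lemma ex_maximal_null_set mu nu : exists N,
  [/\ measurable N, nu N = 0 &
      forall A, measurable A -> nu A = 0 -> mu (A `\` N) = 0].
Proof.
pose null := [set A | measurable A /\ nu A = 0].
pose s := ereal_sup [set mu A | A in null].
have s_ub A : measurable A -> nu A = 0 -> mu A <= s.
  by move=> mA A0; apply: ereal_sup_ubound; exists A.
(* Finiteness of [s], which lies between [mu set0] and [mu setT], permits the choice of null sets
   [F n] with [mu]-measure within [1/(n+1)] of [s]. *)
have s_fin : s \is a fin_num.
  rewrite ge0_fin_numE; last by rewrite -(measure0 mu) s_ub.
  apply: (@le_lt_trans _ _ (mu setT)); last exact: finite_measure_lty.
  by apply: ge_ereal_sup => _ [A [mA _] <-]; rewrite le_measure ?inE.
have /choice[F nullF] n :
    exists A, null A /\ s - n.+1%:R^-1%:E < mu A.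
  have /(@ub_ereal_sup_adherent _ [set mu A | A in null]) :
    (0 < n.+1%:R^-1 :> R)%R by rewrite invr_gt0.
  by move=> /(_ s_fin)[_ [A nA <-] sA]; exists A.
have mF n : measurable (F n) by have [[]] := nullF n.
pose N := \bigcup_n F n.
have mN : measurable N by exact: bigcup_measurable.
have N0 : nu N = 0.
  apply: measure_negligible => //; apply: negligible_bigcup => n.
  by apply/negligibleP => //; have [[]] := nullF n.
have sN : s <= mu N.
  apply/lee_addgt0Pr => e e0.
  rewrite -leeBlDr//; have [n ne] := ltr_add_invr e0.
  rewrite add0r in ne.
  apply: (@le_trans _ _ (s - n.+1%:R^-1%:E)).
    by rewrite leeB// lee_fin ltW.
  have [_ /ltW/le_trans] := nullF n; apply.
  by rewrite le_measure ?inE//; exact: bigcup_sup.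
exists N; split=> // A mA A0.
apply/eqP; rewrite eq_le measure_ge0 andbT.
(* Adding the finite value [mu N] turns the goal into a bound on the measure of the union of [N] and
   [A], a null set again, hence of measure at most [s]. *)
rewrite -(@leeD2lE _ (mu N)) ?fin_num_measure// adde0.
rewrite -measureU//; last by rewrite setDIK.
  apply: le_trans sN.
  have -> : N `|` A `\` N = N `|` A by rewrite setUDr setDv setD0.
  apply: s_ub; first exact: measurableU.
  by rewrite measureU0.
exact: measurableD.
Qed.

(* A Hahn decomposition of alpha - nu splits the space into a part P where
   nu <= alpha and a part M where alpha <= nu; nu restricted to P and alpha
   restricted to M both lie below alpha and nu, so they vanish. *)
Lemma dominated_singular_eq0 nu (alpha : {finite_measure set T -> \bar R}) :
  content_dominates nu alpha -> singular alpha nu -> alpha setT = 0.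
Proof.
move=> alpha_nu alpha_sing.
pose delta := cadd (charge_of_finite_measure alpha)
  (cscale (-1) (charge_of_finite_measure nu)).
have deltaE A : delta A = alpha A - nu A.
  by rewrite /delta /cadd /= /cscale /= EFinN mulN1e.
have [P [M [[mP P_pos] [mM M_neg] PM PM0]]] :=
  Hahn_decomposition delta.
have nuP A : measurable A -> nu (A `&` P) <= alpha (A `&` P).
  move=> mA; have mAP := measurableI _ _ mA mP.
  have : 0 <= delta (A `&` P) by exact: P_pos.
  by rewrite deltaE sube_ge0// fin_num_measure.
have alphaM A : measurable A -> alpha (A `&` M) <= nu (A `&` M).
  move=> mA; have mAM := measurableI _ _ mA mM.
  have : delta (A `&` M) <= 0 by exact: M_neg.
  by rewrite deltaE sube_le0// fin_num_measure.
have nuP0 : nu P = 0.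
  have le_alpha : measure_le (restriction nu mP) alpha.
    by move=> A mA; apply: le_trans (nuP A mA) _; exact: measureIl.
  have := alpha_sing _ le_alpha (@restriction_le _ _ _ nu _ mP) _ measurableT.
  by rewrite restrictionE setTI.
have alphaM0 : alpha M = 0.
  have le_nu : measure_le (restriction alpha mM) nu.
    by move=> A mA; apply: le_trans (alphaM A mA) _; exact: measureIl.
  have := alpha_sing _ (@restriction_le _ _ _ alpha _ mM) le_nu _ measurableT.
  by rewrite restrictionE setTI.
(* Singularity only kills [nu] on [P]; absolute continuity then gives [alpha P = 0]. *)
by rewrite -PM measureU//= alphaM0 adde0 alpha_nu.
Qed.

Lemma content_dominates_le nu (alpha beta : {finite_measure set T -> \bar R}) :
  measure_le alpha beta -> content_dominates nu beta ->
  content_dominates nu alpha.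
Proof.
move=> le_ab nu_b A mA A0.
by apply/eqP; rewrite eq_le measure_ge0 andbT -(nu_b A mA A0) le_ab.
Qed.

Lemma singular_le nu (alpha beta : {finite_measure set T -> \bar R}) :
  measure_le alpha beta -> singular beta nu -> singular alpha nu.
Proof.
move=> le_ab sing_b eta le_eta; apply: sing_b => A mA.
exact: le_trans (le_eta A mA) (le_ab A mA).
Qed.

(** A measure below both vanishes off [N] because the restriction does, and on [N] because [nu]
    does. *)
Lemma null_set_singular mu nu N (mN : measurable N) :
  nu N = 0 -> singular (restriction mu mN) nu.
Proof.
move=> N0 eta le_mu le_nu A mA.
have mAN := measurableD mA mN; have mAIN := measurableI _ _ mA mN.
apply/eqP; rewrite eq_le measure_ge0 andbT (measureDI eta mA mN).
rewrite -[leRHS]adde0; apply: leeD.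
  by apply: le_trans (le_mu _ mAN) _; rewrite restrictionE setDKI measure0.
by apply: le_trans (le_nu _ mAIN) _; rewrite -[leRHS]N0; exact: measureIr.
Qed.

End null_sets_and_singularity.

Theorem mainTheorem1 (d : measure_display) (X : measurableType d)
    (R : realType) (mu nu : {finite_measure set X -> \bar R}) :
  exists mu_ac mu_s : {finite_measure set X -> \bar R},
    lebesgue_decomposition mu nu mu_ac mu_s /\
    forall mu_ac' mu_s' : {finite_measure set X -> \bar R},
      lebesgue_decomposition mu nu mu_ac' mu_s' ->
      measure_eq mu_ac' mu_ac /\ measure_eq mu_s' mu_s.
Proof.
have [N [mN N0 maxN]] := ex_maximal_null_set mu nu.
have mNC := measurableC mN.
have off_nu : content_dominates nu (restriction mu mNC).
  by move=> A mA A0; rewrite restrictionE -setDE maxN.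
exists (restriction mu mNC), (restriction mu mN).
split.
  split => //; last exact: null_set_singular.
  by move=> A mA /=; rewrite !restrictionE -setDE -measureDI.
move=> ac s [mu_dec ac_nu s_sing].
have s_le_mu : measure_le s mu.
  by move=> A mA; rewrite mu_dec//= leeDr.
have off_le : measure_le (restriction s mNC) (restriction mu mNC).
  by move=> A mA; rewrite s_le_mu//; exact: measurableI.
(* This value is the total mass of [restriction s mNC], which inherits absolute continuity from [mu]
   off [N] and singularity from [s]. *)
have sNC0 : s (~` N) = 0.
  rewrite -[~` N]setTI -(restrictionE s mNC).
  apply: (@dominated_singular_eq0 _ _ _ nu).
    exact: content_dominates_le off_le off_nu.
  exact: singular_le (@restriction_le _ _ _ _ _ _) s_sing.
have sD0 A : measurable A -> s (A `\` N) = 0.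
  move=> mA; apply/eqP; rewrite eq_le measure_ge0 andbT -sNC0 setDE.
  exact: measureIr.
have acI0 A : measurable A -> ac (A `&` N) = 0.
  move=> mA; apply/eqP; rewrite eq_le measure_ge0 andbT -(ac_nu N mN N0).
  exact: measureIr.
(* Now [ac] lives off [N] and [s] on [N], so splitting [A] along [N] identifies each with the
   matching restriction of [mu]. *)
split=> A mA; have mAD := measurableD mA mN; have mAI := measurableI _ _ mA mN.
  rewrite restrictionE -setDE mu_dec//= sD0// adde0.
  by rewrite (measureDI ac mA mN)/= acI0// adde0.
rewrite restrictionE mu_dec//= acI0// add0e.
by rewrite (measureDI s mA mN)/= sD0// add0e.
Qed.
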